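(* Assume the validity of Artin's conjecture. Let $L/K$ be a finite Galois extension of number fields and $\rho$ a non-trivial irreducible finite-dimensional complex representation of $\mathrm{Gal}(L/K)$. Then $\widetilde{L}(s,\rho;L/K)$ is entire, i.e. extends by analytic continuation from $\Re(s)>1$ to an entire function on $\mathbb{C}$.
   Context: The Artin L-function of a finite-dimensional complex representation $\rho:\mathrm{Gal}(L/K)\to\mathrm{GL}(V)$ is $L(s,\rho;L/K)=\prod_{\mathfrak{q}}\det\left(\mathrm{Id}_{V^{I(\mathfrak{q})}}-N(\mathfrak{q})^{-s}\rho(\sigma_{\mathfrak{q}})|_{V^{I(\mathfrak{q})}}\right)^{-1}$ for $\Re(s)>1$, the product being over all (nonzero) prime ideals $\mathfrak{q}$ of the ring of integers $\mathcal{O}_K$, where $N(\mathfrak{q})=|\mathcal{O}_K/\mathfrak{q}|$, $I(\mathfrak{q})\subset D(\mathfrak{q})\subset\mathrm{Gal}(L/K)$ are the inertia and decomposition groups of a chosen prime of $L$ over $\mathfrak{q}$, and $\sigma_{\mathfrak{q}}\in D(\mathfrak{q})/I(\mathfrak{q})$ is the Frobenius element. For $\Re(s)>1$, $\widetilde{L}(s,\rho;L/K):=\prod_{j\ge0}L(s+j,\rho;L/K)$; the infinite product converges to an analytic function on this half plane. Artin's conjecture: for any finite Galois extension $L/K$ of number fields and any non-trivial irreducible complex representation $\rho$ of $\mathrm{Gal}(L/K)$, the function $L(s,\rho;L/K)$ may be extended by analytic continuation to an entire function on $\mathbb{C}$. *)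

(* Defs.v *)
(* Conventions.  A number field is a [fieldExtType rat]; a finite Galois
   extension L/K is a [splittingFieldType K] with [galois 1%VS {:L}], and its
   Galois group is ['Gal({:L} / 1)].  The complex numbers are R[i], R a
   [realType]; the alias R[i]^o carries the norm topology of R[i] over itself, so
   that [derivable f z 1] is complex differentiability. *)
From HB Require Import structures.
From mathcomp Require Import all_boot all_order all_algebra all_fingroup.
From mathcomp Require Import all_field mxrepresentation.
From mathcomp Require Import finmap complex.
From mathcomp Require Import all_classical all_reals all_analysis.
From mathcomp Require Import summability.

Set Implicit Arguments.
Unset Strict Implicit.
Unset Printing Implicit Defensive.

Import Order.TTheory GRing.Theory Num.Theory.
Import numFieldNormedType.Exports.

Local Open Scope classical_set_scope.
Local Open Scope ring_scope.
Local Open Scope complex_scope.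

Definition integer_pred (F : fieldType) : {pred F} :=
  fun x => `[< integralOver (intr : int -> F) x >].
Arguments integer_pred : clear implicits.

Lemma integer_subring (F : fieldType) : subring_closed (integer_pred F).
Proof.
split=> [|x y /asboolP ix /asboolP iy|x y /asboolP ix /asboolP iy];
  apply/asboolP.
- exact: integral1.
- exact: integral_sub.
- exact: integral_mul.
Qed.

HB.instance Definition _ (F : fieldType) :=
  GRing.isSubringClosed.Build F (integer_pred F) (@integer_subring F).

Record integers (F : fieldType) := Integer {
  integer_val : F;
  _ : integer_val \in integer_pred F }.

HB.instance Definition _ (F : fieldType) := [isSub for @integer_val F].
HB.instance Definition _ (F : fieldType) := [Choice of integers F by <:].
HB.instance Definition _ (F : fieldType) :=
  [SubChoice_isSubComNzRing of integers F by <:].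

Lemma integer_rmorph (F E : fieldType) (f : {rmorphism F -> E})
  (x : integers F) : f (val x) \in integer_pred E.
Proof.
case: x => x /= /asboolP ix; apply/asboolP.
have /= := integral_rmorph f ix.
by case=> p pm pr; exists p => //; rewrite -(eq_map_poly (rmorph_int f)).
Qed.

Definition integer_map (F E : fieldType) (f : {rmorphism F -> E})
  (x : integers F) : integers E := Integer (integer_rmorph f x).

Definition nonzero_prime_ideal (A : comNzRingType) (q : set A) : Prop :=
  [/\ idealr_closed (mem q), prime_idealr_closed (mem q) & q != [set 0]].

Definition prime_of (F : fieldType) : Type :=
  {q : set (integers F) | `[< nonzero_prime_ideal q >]}.
HB.instance Definition _ (F : fieldType) := Choice.on (prime_of F).

(* The underlying set of the quotient ring A / q. *)
Definition residue_classes (A : comNzRingType) (q : set A) : set (set A) :=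
  range (fun x : A => [set y | q (y - x)]).

Definition ideal_norm (F : fieldType) (q : prime_of F) : nat :=
  #|` fset_set (residue_classes (sval q))|.

Section Galois.
Variables (K : fieldExtType rat) (L : splittingFieldType K).

Local Notation OL := (integers L).
Local Notation G := 'Gal({:L} / 1%VS)%g.

(* Q is a nonzero prime of O_L whose contraction along O_K -> O_L is q. *)
Definition lies_over (Q : set OL) (q : set (integers K)) : Prop :=
  nonzero_prime_ideal Q /\ integer_map (in_alg L) @^-1` Q = q.

Definition chosen_prime_above (q : prime_of K) : set OL :=
  xget set0 [set Q | lies_over Q (sval q)].

Definition gal_integer (g : gal_of {:L}) : OL -> OL := integer_map g.

Definition decomposition_group (Q : set OL) : {set gal_of {:L}} :=
  [set g in G | `[< gal_integer g @` Q = Q >]].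

Definition inertia_group (Q : set OL) : {set gal_of {:L}} :=
  [set g in decomposition_group Q |
     `[< forall x : OL, Q (gal_integer g x - x) >]].

(* g lifts the Frobenius element of D(Q)/I(Q): it induces x |-> x ^ N(q) on
   O_L / Q.  This determines g modulo the inertia group. *)
Definition is_frobenius (q : prime_of K) (Q : set OL) (g : gal_of {:L}) :=
  g \in decomposition_group Q /\
  forall x : OL, Q (gal_integer g x - x ^+ ideal_norm q).

Definition frobenius (q : prime_of K) : gal_of {:L} :=
  xget 1%g [set g | is_frobenius q (chosen_prime_above q) g].

End Galois.
Arguments chosen_prime_above {K} L q.
Arguments frobenius {K} L q.

Section LFunctions.
Variable R : realType.
Local Notation C := (R[i]^o).

Definition cexp (z : C) : C :=
  (expR (complex.Re z))%:C * (cos (complex.Im z) +i* sin (complex.Im z)).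

Definition nat_cpow (N : nat) (z : C) : C := cexp (z * (ln (N%:R : R))%:C).

Definition entire (f : C -> C) : Prop := forall z : C, derivable f z 1.

Definition extends_to_entire (f : C -> C) : Prop :=
  exists2 F : C -> C, entire F &
    forall s : C, 1 < complex.Re s -> F s = f s.

Section Artin.
Variables (K : fieldExtType rat) (L : splittingFieldType K) (n : nat).
Variable rho : mx_representation R[i] 'Gal({:L} / 1%VS)%g n.

(* Matrices act on row vectors, and products in ['Gal({:L} / 1)] satisfy
   (g * h) a = h (g a), so v |-> v *m rho g is a left action of the Galois group
   for the usual composition of automorphisms.  The row space of [rfix_mx rho H]
   is the subspace of vectors fixed by H, and [restrictmx V A] is the matrix, in
   a basis of the row space of V, of the restriction of A to that row space. *)
Definition euler_factor (s : C) (q : prime_of K) : C :=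
  let V := rfix_mx rho (inertia_group (chosen_prime_above L q)) in
  (\det (1%:M - nat_cpow (ideal_norm q) (- s) *:
           restrictmx V (rho (frobenius L q))))^-1.

(* The product over the primes is the limit of the finite partial products along
   the net of finite sets of primes ordered by inclusion.  As with any [lim],
   [artin_L] and [artin_Ltilde] are only meaningful where the product converges,
   in particular for Re s > 1. *)
Definition artin_L (s : C) : C :=
  lim ((fun J : {fset prime_of K} => \prod_(q <- J) euler_factor s q)
       @ totally).

Definition artin_Ltilde (s : C) : C :=
  lim ((fun k : nat => \prod_(0 <= j < k) artin_L (s + j%:R)) @ \oo).

Definition nontrivial_repr : Prop :=
  exists2 g, g \in 'Gal({:L} / 1%VS)%g & rho g != 1%:M.

End Artin.

Definition artin_conjecture : Prop :=
  forall (K : fieldExtType rat) (L : splittingFieldType K) (n : nat)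
    (rho : mx_representation R[i] 'Gal({:L} / 1%VS)%g n),
  galois 1%VS {:L} -> mx_irreducible rho -> nontrivial_repr rho ->
  extends_to_entire (artin_L rho).

End LFunctions.

(* Main.v *)
(* By Artin's conjecture L(s) extends to an entire function F.  For Re s > 1 the
   product defining Ltilde(s) is that of the F(s + j), so the candidate for the
   continuation is G(s) = lim_n prod_(j < n) F(s + j), and for every k, locally,
     G(s) = (prod_(j < k) F(s + j)) * Ltilde(s + k).
   It remains to see that Ltilde is holomorphic far to the right, where the
   Euler products converge absolutely.

   Holomorphy of these infinite products is obtained without Cauchy's theory.
   The 2-jets f(w + h) = f0 + f1 h + O(|h|^2) on the unit disc around w carry
   the norm |f0| + |f1| + (constant of the O); it is submultiplicative and stable
   under pointwise limits, so a product of factors 1 + g_i whose jet norms are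
   summable converges to a function that again has a 2-jet at w, hence is
   differentiable there.

   The jet norm of N(q)^(-s) is at most 6 N(q)^(-2) 2^(-j) when Re s >= j + 5,
   and the sum of the N(q)^(-2) is finite because N(q) >= p for the prime p below q
   and at most [K : Q] primes lie over p: elements of O_K separating the primes
   over p are linearly independent modulo p, whereas any [K : Q] + 1 elements of
   O_K satisfy an integral relation whose coefficients are not all divisible by
   p. *)
Require Import Defs.
From HB Require Import structures.
From mathcomp Require Import all_boot all_order all_algebra all_fingroup.
From mathcomp Require Import all_field mxrepresentation complex.
From mathcomp Require Import all_classical all_reals all_analysis.
From mathcomp Require Import finmap summability ring lra.

Set Implicit Arguments.
Unset Strict Implicit.
Unset Printing Implicit Defensive.

Import Order.TTheory GRing.Theory Num.Theory.
Import numFieldNormedType.Exports.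

Local Open Scope classical_set_scope.
Local Open Scope ring_scope.
Local Open Scope complex_scope.

(** * Primes of the ring of integers *)

Section RealSums.
Variable R : realType.

Lemma sum_fset_nat_le (u : nat -> R) (S : R) (J : {fset nat}) :
  (forall i, 0 <= u i) -> (forall n, \sum_(i < n) u i <= S) ->
  \sum_(i <- J) u i <= S.
Proof.
move=> u0 HS; pose n := (\max_(i <- J) i).+1.
have Jn i : i \in J -> (i < n)%N by move=> iJ; rewrite ltnS leq_bigmax_seq.
have JP : perm_eq J [seq i <- index_iota 0 n | i \in J].
  apply: uniq_perm; rewrite ?fset_uniq ?filter_uniq ?iota_uniq // => i.
  rewrite mem_filter mem_index_iota /=.
  by case: (boolP (i \in J)) => // /Jn ->.
apply: le_trans (HS n).
rewrite (perm_big _ JP) big_filter -(big_mkord xpredT u) big_mkcond.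
by apply: ler_sum => i _; case: ifP.
Qed.

Lemma sum_exp2V_le (n : nat) : \sum_(i < n) (2 ^+ i)^-1 <= 2 :> R.
Proof.
suff : \sum_(i < n) (2 ^+ i)^-1 = 2 - 2 * (2 ^+ n)^-1 :> R.
  move=> ->; rewrite lerBlDr lerDl mulr_ge0 // invr_ge0 exprn_ge0 //.
elim: n => [|n IH]; first by rewrite big_ord0 expr0 invr1 mulr1 subrr.
rewrite big_ord_recr /= IH exprS; field.
by rewrite expf_neq0.
Qed.

(** The term [i = 0] vanishes because [0^-1 = 0]; the others telescope, since 1/(k+1)^2 <= 1/k -
    1/(k+1). *)
Lemma sum_sqV_le (n : nat) : \sum_(i < n) ((i%:R ^+ 2)^-1 : R) <= 2.
Proof.
case: n => [|n]; first by rewrite big_ord0.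
rewrite big_ord_recl expr0n invr0 add0r.
case: n => [|n]; first by rewrite big_ord0.
suff : \sum_(i < n.+1) ((bump 0 i)%:R ^+ 2)^-1 <= 2 - (n.+1%:R)^-1 :> R.
  by move=> /le_trans; apply; rewrite lerBlDr lerDl invr_ge0.
elim: n => [|n IH].
  by rewrite big_ord_recr big_ord0 /bump /= add0r !expr1n invr1; lra.
rewrite big_ord_recr /=; apply: le_trans (lerD IH (lexx _)) _.
rewrite /bump leq0n add1n -[n.+2%:R]natr1 -[n.+1%:R]natr1; set x : R := n%:R.
have x0 : 0 <= x by rewrite ler0n.
rewrite -subr_ge0.
have -> : 2 - (x + 1 + 1)^-1 - (2 - (x + 1)^-1 + ((x + 1 + 1) ^+ 2)^-1) =
    ((x + 1) * (x + 2) ^+ 2)^-1.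
  by field; rewrite !lt0r_neq0 //; lra.
by rewrite invr_ge0 mulr_ge0 ?sqr_ge0 //; lra.
Qed.

Lemma exp2_arch (x : R) :
  exists j0, forall j, (j0 <= j)%N -> x * (2 ^+ j)^-1 <= 1.
Proof.
exists (Num.bound `|x|) => j Hj.
rewrite ler_pdivrMr ?exprn_gt0 // mul1r.
have : x <= j%:R.
  apply: le_trans (ler_norm x) _.
  apply: le_trans (ltW (archi_boundP _)) _ => //.
  by rewrite ler_nat.
move=> /le_trans; apply; rewrite -natrX ler_nat ltnW //.
exact: ltn_expl.
Qed.

End RealSums.

(** * Integral linear relations in a number field *)

Section RingOfIntegers.
Variable K : fieldExtType rat.
Local Notation O := (integers K).

Lemma rat_relation (n : nat) (x : 'I_n -> K) : (\dim {:K} < n)%N ->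
  exists k : 'I_n -> rat, \sum_i k i *: x i = 0 /\ exists i, k i != 0.
Proof.
move=> dn; pose X := [tuple x i | i < n].
have : ~~ free X.
  rewrite /free neq_ltn size_tuple (leq_ltn_trans _ dn) //.
  by rewrite dimvS // subvf.
move/freeP => H; apply: contrapT => H'; apply: H => k Hk i.
apply: contrapT => /eqP ki; apply: H'; exists k; split; last by exists i.
rewrite -[RHS]Hk; apply: eq_bigr => j _.
by rewrite (nth_map j) ?size_enum_ord // nth_ord_enum.
Qed.

Lemma int_relation (n : nat) (x : 'I_n -> K) : (\dim {:K} < n)%N ->
  exists c : 'I_n -> int, \sum_i (c i)%:~R * x i = 0 /\ exists i, c i != 0.
Proof.
move=> /(rat_relation x)[k [kx [i0 ki0]]].
(* The rational coefficients [k i] multiplied by the product of all their denominators. *)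
exists (fun i => numq (k i) * \prod_(j | j != i) denq (k j)); split; last first.
  exists i0; rewrite mulf_neq0 ?numq_eq0 //.
  by apply/prodf_neq0 => j _; rewrite denq_neq0.
have E i : (numq (k i) * \prod_(j | j != i) denq (k j))%:~R =
    k i * (\prod_j denq (k j))%:~R :> rat.
  by rewrite rmorphM /= numqE [in RHS](bigD1 i) //= rmorphM /= mulrA.
have -> : \sum_i (numq (k i) * \prod_(j | j != i) denq (k j))%:~R * x i =
    (\prod_j denq (k j))%:~R *: (\sum_i k i *: x i).
  rewrite scaler_sumr; apply: eq_bigr => i _.
  by rewrite scalerA [_%:~R * k i]mulrC -E scaler_int mulrzl.
by rewrite kx scaler0.
Qed.

(** Descent on the absolute value of one nonzero coefficient: while [p] divides every coefficient,
    the relation can be divided by [p], as K has characteristic 0. *)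
Lemma primitive_relation (n : nat) (x : 'I_n -> O) (p : nat) :
  (\dim {:K} < n)%N -> (1 < p)%N ->
  exists c : 'I_n -> int, \sum_i (c i)%:~R * x i = 0 /\
    exists i, ~~ (p %| c i)%Z.
Proof.
move=> dn p1; have [c [cx [i0 ci0]]] := int_relation (fun i => val (x i)) dn.
move: {2}`|c i0|%N (leqnn `|c i0|) => m.
elim: m c cx ci0 => [|m IH] c cx ci0 cm.
  by move: ci0; rewrite -absz_eq0 -leqn0 cm.
have [[i Hi]|all] := pselect (exists i, ~~ (p %| c i)%Z).
  exists c; split; last by exists i.
  apply: val_inj; rewrite rmorph_sum rmorph0 -[RHS]cx; apply: eq_bigr => j _.
  by rewrite rmorphM rmorph_int.
have pc i : (c i = (c i %/ p)%Z * p%:Z).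
  by rewrite divzK //; apply: contrapT => /negP H; apply: all; exists i.
have p0 : (p%:Z%:~R : K) != 0.
  by rewrite -(rmorph_int (in_alg K)) fmorph_eq0 intr_eq0 -lt0n ltnW.
apply: (IH (fun i => (c i %/ p)%Z)).
- apply: (mulIf p0); rewrite mul0r mulr_suml -[RHS]cx; apply: eq_bigr => i _.
  by rewrite mulrAC [in RHS](pc i) rmorphM.
- by apply: contra ci0 => /eqP H; rewrite (pc i0) H mul0r.
rewrite -ltnS (leq_trans _ cm) // [in ltnRHS](pc i0) abszM /=.
rewrite ltn_Pmulr // absz_gt0.
by apply: contra ci0 => /eqP H; rewrite (pc i0) H mul0r.
Qed.
End RingOfIntegers.

(** * Nonzero prime ideals and their residue rings *)

Section PrimeIdeals.
Variable K : fieldExtType rat.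
Local Notation O := (integers K).
Local Notation d := (\dim {:K}).

Section OnePrime.
Variable q : set O.
Hypothesis qP : nonzero_prime_ideal q.

Lemma ideal_0 : q 0.
Proof. by case: qP => -[/set_mem]. Qed.

Lemma ideal_1 : ~ q 1.
Proof. by case: qP => -[_ /negP H _] _ _ q1; apply/H/mem_set. Qed.

Lemma ideal_MD a u v : q u -> q v -> q (a * u + v).
Proof.
move=> /mem_set qu /mem_set qv; case: qP => -[_ _ H] _ _.
exact/set_mem/(H a u v qu qv).
Qed.

Lemma ideal_M a u : q u -> q (a * u).
Proof.
by move=> qu; rewrite -[_ * _]addr0; apply: ideal_MD => //; exact: ideal_0.
Qed.

Lemma ideal_D u v : q u -> q v -> q (u + v).
Proof. by move=> qu qv; rewrite -[u]mul1r; exact: ideal_MD. Qed.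

Lemma ideal_N u : q u -> q (- u).
Proof. by move=> qu; rewrite -mulN1r; exact: ideal_M. Qed.

Lemma ideal_sum (I : Type) (r : seq I) (P : pred I) (F : I -> O) :
  (forall i, P i -> q (F i)) -> q (\sum_(i <- r | P i) F i).
Proof. by move=> H; apply: big_ind => //; [exact: ideal_0|exact: ideal_D]. Qed.

Lemma ideal_prime u v : q (u * v) -> q u \/ q v.
Proof.
move=> /mem_set quv; case: qP => _ /(_ u v quv) + _.
by case/orP => /set_mem H; [left|right].
Qed.

(** A nonzero x in q is a root of a nonzero integer polynomial P = P' X + c. If c is nonzero, then c
    = - P'(x) x lies in q; otherwise x cancels and P' replaces P. *)
Lemma ideal_int_neq0 : exists2 m : int, m != 0 & q m%:~R.
Proof.
have [x x0 qx] : exists2 x : O, x != 0 & q x.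
  case: qP => _ _ /eqP q0; apply: contrapT => H; apply: q0.
  apply/seteqP; split=> [x qx /=|x ->]; last exact: ideal_0.
  by apply: contrapT => /eqP x0; apply: H; exists x.
have [P [P0 Px]] : exists P : {poly int},
    P != 0 /\ (map_poly intr P).[x] = 0 :> O.
  case: (x) => y /= yi; have [p pm pr] := asboolW yi.
  exists p; split; first exact: monic_neq0.
  apply: val_inj; rewrite rmorph0 -[RHS](rootP pr) -horner_map /=.
  have vi (z : int) : val (z%:~R : O) = z%:~R by exact: rmorph_int.
  by congr (_.[_]); apply/polyP => i; rewrite !coef_map_id0 //= vi.
elim/poly_ind: P P0 Px => [|P c IH]; first by rewrite eqxx.
rewrite rmorphD rmorphM /= map_polyX map_polyC hornerMXaddC => P0 Px.
have [c0|c0] := eqVneq c 0; last first.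
  exists c => //; move/eqP: Px; rewrite addrC addr_eq0 => /eqP ->.
  by apply: ideal_N; exact: ideal_M.
move: P0 Px; rewrite {}c0 rmorph0 !addr0 => P0 Px; apply: IH.
  by apply: contra P0 => /eqP ->; rewrite mul0r.
move/(congr1 val)/eqP: Px; rewrite rmorphM rmorph0 mulf_eq0.
move=> /orP[/eqP H|/eqP H]; first by apply: val_inj; rewrite H rmorph0.
by case/eqP: x0; apply: val_inj; rewrite H rmorph0.
Qed.

(** Strong induction on a positive integer n in q: primality of q puts either the least prime
    divisor of n or its cofactor in q. *)
Lemma ideal_has_prime : exists p : nat, prime p && `[< q p%:R >].
Proof.
have [m m0 qm] := ideal_int_neq0.
have qn : q `|m|%N%:R.
  case: (m) qm => k; first by rewrite -pmulrn.
  by rewrite NegzE rmorphN /= -pmulrn => /ideal_N; rewrite opprK.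
have := m0; rewrite -absz_gt0; move: `|m|%N qn => n.
elim/ltn_ind: n => n IH qn n0.
have [n1|n1] := leqP n 1.
  have := ideal_1; move: qn; rewrite (_ : n = 1%N) //.
  by apply/eqP; rewrite eqn_leq n1.
have /ideal_prime[qp|qm'] : q ((pdiv n)%:R * (n %/ pdiv n)%:R).
  by rewrite -natrM mulnC divnK // pdiv_dvd.
- by exists (pdiv n); rewrite pdiv_prime //; apply/asboolP.
- apply: IH qm' _; first by rewrite ltn_Pdiv // prime_gt1 // pdiv_prime.
  by rewrite divn_gt0 ?pdiv_gt0 // dvdn_leq // pdiv_dvd.
Qed.

Variable p : nat.
Hypothesis p_prime : prime p.
Hypothesis qp : q p%:R.

Lemma ideal_bezout (c : int) : ~~ (p %| c)%Z ->
  exists u v : int, u * p + v * c = 1.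
Proof.
move=> pc; have : coprimez p c.
  by rewrite coprimezE prime_coprime.
by move=> /coprimezP[[u v] /= E]; exists u, v.
Qed.

Lemma ideal_dvd (c : int) : (p %| c)%Z -> q c%:~R.
Proof.
by move=> /divzK <-; rewrite rmorphM /= -pmulrn; exact: ideal_M.
Qed.

Lemma ideal_int_dvd (c : int) : q c%:~R -> (p %| c)%Z.
Proof.
move=> qc; apply: contrapT => /negP /ideal_bezout[u [v uv]].
apply: ideal_1; rewrite -[1]/(1%:~R) -uv rmorphD /= !rmorphM /=.
by apply: ideal_D; apply: ideal_M => //; rewrite -pmulrn.
Qed.

Lemma ideal_dvdM (c : int) (x : O) : (p %| c)%Z -> q (c%:~R * x).
Proof. by move=> pc; rewrite mulrC; apply/ideal_M/ideal_dvd. Qed.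

(** Linear independence over F_p of the residues in O / q, stated with integer coefficients. *)
Definition indep_mod (r : nat) (x : 'I_r -> O) :=
  forall c : 'I_r -> int, q (\sum_i (c i)%:~R * x i) -> forall i, (p %| c i)%Z.

Lemma indep_mod_size r (x : 'I_r -> O) : indep_mod x -> (r <= d)%N.
Proof.
move=> Hx; rewrite leqNgt; apply/negP => dr.
have [c [cx [i Hi]]] := primitive_relation x dr (prime_gt1 p_prime).
by move/negP: Hi; apply; apply: Hx; rewrite cx; exact: ideal_0.
Qed.

(* A maximal family independent modulo p spans O / q over F_p. *)
Lemma residue_spanned : exists r (x : 'I_r -> O), forall y : O,
  exists f : {ffun 'I_r -> 'I_p}, q (y - \sum_i (f i)%:R * x i).
Proof.
pose P r := `[< exists x : 'I_r -> O, indep_mod x >].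
have P0 : exists r, P r.
  exists 0%N; apply/asboolP; exists (fun=> 0) => c _ [i Hi] //.
have Pd r : P r -> (r <= d)%N by move=> /asboolP[x]; exact: indep_mod_size.
case: (ex_maxnP P0 Pd) => r /asboolP[x Hx] rmax; exists r, x => y.
pose x' (i : 'I_r.+1) := if unlift ord_max i is Some j then x j else y.
have : ~ indep_mod x'.
  move=> Hx'; have /rmax : P r.+1 by apply/asboolP; exists x'.
  by rewrite ltnn.
move=> /existsNP[c /not_implyP[qc /existsNP[i0 Hi0]]].
move: qc; rewrite (bigD1 ord_max) //= {1}/x' unlift_none.
have -> : \sum_(i < r.+1 | i != ord_max) (c i)%:~R * x' i =
   \sum_i (c (lift ord_max i))%:~R * x i.
  rewrite (reindex_omap (lift ord_max) (unlift ord_max)) /=.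
    apply: eq_big => [i|i _]; last by rewrite /x' liftK.
    by rewrite eq_sym neq_lift liftK eqxx.
  by move=> i; case: unliftP => [j ->|->] //=; rewrite eqxx.
move=> qc.
have cp : ~~ (p %| c ord_max)%Z.
  apply/negP => pc; apply: Hi0.
  have qc' : q (\sum_i (c (lift ord_max i))%:~R * x i).
    rewrite -[\sum_i _](addKr ((c ord_max)%:~R * y)).
    by apply: ideal_D => //; apply/ideal_N/ideal_dvdM.
  by case: (unliftP ord_max i0) => [j ->|-> //]; exact: Hx qc' j.
(* The coefficient of [y] is invertible modulo [p] with inverse [v], so y is congruent to - v times
   the rest of the relation; [e] holds these coefficients, which are then reduced modulo [p]. *)
have [u [v uv]] := ideal_bezout cp.
have pz : p%:Z != 0 by rewrite -lt0n prime_gt0.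
have [e eE] : exists e : 'I_r -> int, forall i, e i = - v * c (lift ord_max i).
  by exists (fun i => - v * c (lift ord_max i)).
have ep i : (`|(e i %% p)%Z| < p)%N.
  by rewrite -ltz_nat gez0_abs ?modz_ge0 // ltz_pmod // ltz_nat prime_gt0.
exists [ffun i => Ordinal (ep i)].
have -> : y - \sum_i ([ffun i => Ordinal (ep i)] i)%:R * x i =
  u%:~R * y * p%:R
   + v%:~R * ((c ord_max)%:~R * y + \sum_i (c (lift ord_max i))%:~R * x i)
   + \sum_i ((e i %/ p)%Z%:~R * x i) * p%:R.
  have -> : \sum_i ([ffun i => Ordinal (ep i)] i)%:R * x i =
     \sum_i ((e i)%:~R * x i - (e i %/ p)%Z%:~R * x i * p%:R).
    apply: eq_bigr => i _; rewrite ffunE /=.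
    have -> : (`|(e i %% p)%Z|)%:R = (e i %% p)%Z%:~R :> O.
      by rewrite -[in RHS](gez0_abs (modz_ge0 _ pz)) -pmulrn.
    by rewrite /modz rmorphB rmorphM /=; ring.
  rewrite sumrB.
  have -> : \sum_i (e i)%:~R * x i =
      - v%:~R * \sum_i (c (lift ord_max i))%:~R * x i.
    rewrite mulr_sumr; apply: eq_bigr => i _.
    by rewrite eE rmorphM rmorphN /= mulrA.
  have yE : y = u%:~R * y * p%:R + v%:~R * ((c ord_max)%:~R * y).
    have : (u * p + v * c ord_max)%:~R * y = y by rewrite uv mul1r.
    by rewrite rmorphD !rmorphM /= => {1}<-; ring.
  by rewrite [y in LHS]yE; ring.
apply: ideal_D; last by apply: ideal_sum => i _; exact: ideal_M.
by apply: ideal_D; exact: ideal_M.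
Qed.

(** [fset_set] is empty on an infinite set, so finiteness is what makes [ideal_norm] the true
    cardinality. *)
Lemma finite_residue_classes : finite_set (residue_classes q).
Proof.
have [r [x Hx]] := residue_spanned.
pose cls (y : O) := [set z | q (z - y)]%classic.
apply: (@sub_finite_set _ _
   [set cls (\sum_i (f i)%:R * x i) | f in [set: {ffun 'I_r -> 'I_p}]]%classic).
  move=> _ [y _ <-]; have [f qf] := Hx y; exists f => //.
  apply/seteqP; split=> z /= H.
    by have := ideal_D H (ideal_N qf); rewrite opprB addrA subrK.
  by have := ideal_D H qf; rewrite addrA subrK.
exact/finite_image/finite_finset.
Qed.

(** The integers 0, ..., p - 1 have distinct classes because the integers lying in q are the
    multiples of p. *)
Lemma card_residue_classes : (p <= #|` fset_set (residue_classes q)|)%N.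
Proof.
pose cls (y : O) := [set z | q (z - y)]%classic.
rewrite -[p in (p <= _)%N](size_iota 0) -(size_map (fun i : nat => cls i%:R)).
apply: uniq_leq_size.
  rewrite map_inj_in_uniq ?iota_uniq // => i j.
  rewrite !mem_iota !add0n /= => ip jp ij.
  have : cls j%:R i%:R by rewrite -ij /cls /= subrr; exact: ideal_0.
  rewrite /cls /=.
  have -> : (i%:R - j%:R : O) = (i%:Z - j%:Z)%:~R.
    by rewrite rmorphB /= -!pmulrn.
  move=> /ideal_int_dvd; rewrite -eqz_mod_dvd => /eqP.
  by rewrite !modz_nat !modn_small // => -[->].
move=> _ /mapP[i _ ->]; rewrite in_fset_set; last exact: finite_residue_classes.
by apply/mem_set; exists i%:R.
Qed.
End OnePrime.
End PrimeIdeals.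

(** * Primes over a rational prime, and summability of N(q)^(-2) *)

Section CountingPrimes.
Variable K : fieldExtType rat.
Local Notation O := (integers K).
Local Notation d := (\dim {:K}).

(* Modulo q, the lowest term c_i x^i with p not dividing c_i of a relation
   between the powers of x gives x^i (c_i + x y) = 0, so c_i + x y lies in q. *)
Lemma prime_ideal_incomparable (q r : set O) (p : nat) :
  nonzero_prime_ideal q -> nonzero_prime_ideal r -> prime p -> q p%:R ->
  (q `<=` r)%classic -> (r `<=` q)%classic.
Proof.
move=> qP rP p_prime qp qr x rx; apply: contrapT => nqx.
have rp : r p%:R by exact: qr.
have [c [cx exc]] := primitive_relation (fun i : 'I_d.+1 => x ^+ i) (ltnSn d)
  (prime_gt1 p_prime).
have exc' : exists k, [exists i : 'I_d.+1, (i == k :> nat) && ~~ (p %| c i)%Z].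
  by have [i Hi] := exc; exists i; apply/existsP; exists i; rewrite eqxx.
case: (ex_minnP exc') => k /existsP[i /andP[/eqP ik Hi]] kmin.
have lowdvd (j : 'I_d.+1) : (j < i)%N -> (p %| c j)%Z.
  move=> ji; apply: contrapT => /negP Hj.
  have := kmin j; rewrite -ik leqNgt ji /= => H; apply: notF; apply: H.
  by apply/existsP; exists j; rewrite eqxx.
have nqxk m : ~ q (x ^+ m).
  elim: m => [|m IH]; first by rewrite expr0; exact: ideal_1.
  by rewrite exprS => /(ideal_prime qP) [].
pose y := \sum_(j < d.+1 | (i < j)%N) (c j)%:~R * x ^+ (j - i).-1.
pose z := \sum_(j < d.+1 | (j < i)%N) (c j)%:~R * x ^+ j.
have E : \sum_j (c j)%:~R * x ^+ j = z + x ^+ i * ((c i)%:~R + x * y).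
  rewrite (bigID (fun j : 'I_d.+1 => (j < i)%N)) /=; congr (_ + _).
  rewrite (bigD1 i) ?ltnn //= mulrDr mulrC; congr (_ + _).
  rewrite mulrA mulr_sumr; apply: eq_big => [j|j].
    by rewrite -leqNgt [RHS]ltn_neqAle [RHS]andbC [in RHS]eq_sym.
  move=> /andP[nji ji]; have ij : (i < j)%N.
    by rewrite ltn_neqAle leqNgt nji andbT eq_sym.
  rewrite -exprSr mulrCA -exprD; congr (_ * x ^+ _).
  by rewrite addSnnS prednK ?subn_gt0 // subnKC // ltnW.
have /(ideal_prime qP)[|] : q (x ^+ i * ((c i)%:~R + x * y)).
- rewrite -[_ * _](addKr z) -E cx addr0.
  by apply/(ideal_N qP)/(ideal_sum qP) => j /lowdvd; exact: ideal_dvdM.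
- exact: nqxk.
(* Both [c i + x y] and [x] lie in [r], hence so does [c i], and [p] would divide it. *)
move=> /qr H; move/negP: Hi; apply; apply: (ideal_int_dvd rP p_prime rp).
rewrite -[_%:~R](addrK (x * y)); apply: (ideal_D rP) => //.
by apply: (ideal_N rP); rewrite mulrC; exact: ideal_M.
Qed.

Lemma primes_over_le (p : nat) (J : seq (prime_of K)) :
  prime p -> uniq J -> (forall q, q \in J -> sval q p%:R) -> (size J <= d)%N.
Proof.
move=> p_prime Ju HJ; rewrite leqNgt; apply/negP => dJ.
pose q (i : 'I_(size J)) := sval (tnth (in_tuple J) i).
have qP i : nonzero_prime_ideal (q i).
  exact/asboolP/(svalP (tnth (in_tuple J) i)).
have qp i : q i p%:R by apply/HJ/mem_tnth.
(* [a (i, j)] lies in [q j] but not in [q i]; it exists because distinct primes over [p] are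
   incomparable. *)
have /choice[a Ha] : forall ij : 'I_(size J) * 'I_(size J), exists aij : O,
    ij.1 != ij.2 -> q ij.2 aij /\ ~ q ij.1 aij.
  move=> [i j] /=.
  have [ij|/eqP ij] := eqVneq i j; first by exists 0.
  apply: contrapT => H; apply: ij.
  have qji : (q j `<=` q i)%classic.
    by move=> x qjx; apply: contrapT => nqx; apply: H; exists x.
  have qij := prime_ideal_incomparable (qP j) (qP i) p_prime (qp j) qji.
  have tE : tnth (in_tuple J) i = tnth (in_tuple J) j.
    by apply: val_inj; apply/seteqP.
  have /tuple_uniqP inj : uniq (in_tuple J) by [].
  exact: inj.
(* [x i] lies in every [q j] with j different from i, and not in [q i]. Modulo [q j] a relation
   reduces to its j-th term, which forces [p] to divide [c j]. *)
pose x i := \prod_(j | i != j) a (i, j).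
have [c [cx [j Hj]]] := primitive_relation x dJ (prime_gt1 p_prime).
move/negP: Hj; apply; apply: (ideal_int_dvd (qP j) p_prime (qp j)).
have /(ideal_prime (qP j))[//|] : q j ((c j)%:~R * x j).
  move: cx; rewrite (bigD1 j) //= => /eqP; rewrite addr_eq0 => /eqP ->.
  apply/(ideal_N (qP j))/(ideal_sum (qP j)) => i ij; apply: (ideal_M (qP j)).
  rewrite /x (bigD1 j) //= mulrC; apply: (ideal_M (qP j)).
  by have [] := Ha (i, j) ij.
suff H (P : pred 'I_(size J)) : (forall i, P i -> j != i) ->
    ~ q j (\prod_(i | P i) a (j, i)).
  by move/(H (fun i => j != i)); case.
move=> HP; apply: (big_rec (fun u => ~ q j u)) => [|i u Pi IH].
  exact: ideal_1.
by move/(ideal_prime (qP j)) => [|//]; have [] := Ha (j, i) (HP i Pi).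
Qed.

Lemma prime_below : exists f : prime_of K -> nat,
  forall q, prime (f q) /\ sval q (f q)%:R.
Proof.
suff /choice[f Hf] : forall q : prime_of K, exists p, prime p /\ sval q p%:R.
  by exists f.
move=> q; have qP : nonzero_prime_ideal (sval q) by apply/asboolP/(svalP q).
by have [p /andP[pp /asboolP qp]] := ideal_has_prime qP; exists p.
Qed.

Lemma ideal_norm_ge (q : prime_of K) (p : nat) :
  prime p -> sval q p%:R -> (p <= ideal_norm q)%N.
Proof.
move=> pp qp; apply: card_residue_classes => //.
by apply/asboolP/(svalP q).
Qed.

Lemma ideal_norm_gt1 (q : prime_of K) : (1 < ideal_norm q)%N.
Proof.
have [f Hf] := prime_below; have [fp fq] := Hf q.
exact: leq_trans (prime_gt1 fp) (ideal_norm_ge fp fq).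
Qed.

Lemma sum_ideal_norm_le (R : realType) (J : {fset prime_of K}) :
  \sum_(q <- J) ((ideal_norm q)%:R ^+ 2)^-1 <= d%:R * 2 :> R.
Proof.
have [f Hf] := prime_below.
have fgt0 q : (0 < f q)%N by have [/prime_gt0] := Hf q.
apply: (@le_trans _ _ (\sum_(q <- J) ((f q)%:R ^+ 2)^-1)).
  apply: ler_sum => q _; have [fp fq] := Hf q.
  have le := ideal_norm_ge fp fq.
  rewrite lef_pV2 ?posrE ?exprn_gt0 ?ltr0n //; last exact: leq_trans le.
  by rewrite lerXn2r ?nnegrE // ler_nat.
pose n := (\max_(q <- J) f q).+1.
have fn q : q \in J -> (f q < n)%N by move=> qJ; rewrite ltnS leq_bigmax_seq.
(* Group the primes by the rational prime below; each group has at most d elements. *)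
have -> : \sum_(q <- J) ((f q)%:R ^+ 2)^-1 =
    \sum_(i < n) \sum_(q <- J | f q == i) (i%:R ^+ 2)^-1 :> R.
  rewrite (exchange_big_dep predT) //= [LHS]big_seq [RHS]big_seq.
  apply: eq_bigr => q qJ; rewrite (big_pred1 (Ordinal (fn q qJ))) //.
apply: (@le_trans _ _ (\sum_(i < n) d%:R * (i%:R ^+ 2)^-1)); last first.
  by rewrite -mulr_sumr ler_wpM2l // sum_sqV_le.
apply: ler_sum => i _.
rewrite big_const_seq iter_addr_0 -[_ *+ _]mulr_natl.
rewrite ler_wpM2r ?invr_ge0 ?sqr_ge0 //.
rewrite ler_nat -size_filter.
have [s0|] := posnP (size [seq q <- J | f q == i]); first by rewrite s0.
rewrite -has_predT => /hasP[q0]; rewrite mem_filter => /andP[/eqP fq0 _] _.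
apply: (@primes_over_le i).
- by rewrite -fq0; have [] := Hf q0.
- exact: filter_uniq (fset_uniq _).
- by move=> q; rewrite mem_filter => /andP[/eqP <- _]; have [] := Hf q.
Qed.
End CountingPrimes.

(** * Second-order jets of complex functions *)

Import ComplexField.Normc.
#[local] Existing Instance totally_filter.

(** * Modulus, convergence and completeness of the complex numbers *)

Section ComplexNorm.
Variable R : realType.
Local Notation C := (R[i]^o).

Lemma normcE (z : C) : `|z| = (normc z)%:C.
Proof. by []. Qed.

Lemma normc_ge0 (z : C) : 0 <= normc z.
Proof. by rewrite -lecR -normcE normr_ge0. Qed.

Lemma normc_gt0 (z : C) : z != 0 -> 0 < normc z.
Proof.
by move=> z0; rewrite lt_neqAle normc_ge0 andbT eq_sym;
  apply: contra z0 => /eqP/eq0_normc->.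
Qed.

Lemma normcB (x y : C) : normc (x - y) = normc (y - x).
Proof. by apply: complexI; rewrite -!normcE distrC. Qed.

Lemma Re_le_normc (z : C) : `|complex.Re z| <= normc z.
Proof. by rewrite -lecR; exact: normc_ge_Re. Qed.

Lemma Im_le_normc (z : C) : `|complex.Im z| <= normc z.
Proof.
by case: z => a b /=; rewrite -sqrtr_sqr ler_wsqrtr // lerDr sqr_ge0.
Qed.

Lemma normc_real (x : R) : normc (x%:C : C) = `|x|.
Proof. by rewrite /= expr0n addr0 sqrtr_sqr. Qed.

Lemma normc_le_ReDIm (z : C) : normc z <= `|complex.Re z| + `|complex.Im z|.
Proof.
rewrite [z in normc z]complexE; apply: le_trans (le_normcD _ _) _.
by rewrite normcM !normc_real /= expr0n expr1n add0r sqrtr1 mul1r.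
Qed.

Lemma Re_addn (z : C) (k : nat) : complex.Re (z + k%:R) = complex.Re z + k%:R.
Proof.
by rewrite raddfD /=; congr (_ + _); rewrite -(rmorph_nat (real_complex R)).
Qed.

(** The order on [R[i]] is partial and its positive elements are real, so convergence can be tested
    with e in [R]. *)
Lemma cvgc_distP T (F : set_system T) (FF : Filter F) (f : T -> C) (l : C) :
  (forall e : R, 0 < e -> \forall x \near F, normc (l - f x) < e) <->
  f @ F --> l.
Proof.
split=> [H|/cvgrPdist_lt H e e0].
  apply/cvgrPdist_lt => e; case: e => a b; rewrite ltcE /= => /andP[/eqP -> a0].
  by near=> x; rewrite normcE ltcR; near: x; exact: H.
have := H e%:C; rewrite ltcR => /(_ e0).
by apply: filterS => x; rewrite normcE ltcR.
Unshelve. all: by end_near. Qed.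

(** Completeness, obtained from that of [R] through real and imaginary parts; the approximation [l]
    may vary with [e]. *)
Lemma complexc_cauchy T (F : set_system T) (FF : ProperFilter F) (f : T -> C) :
  (forall e : R, 0 < e -> exists l, \forall x \near F, normc (l - f x) < e) ->
  exists l : C, f @ F --> l.
Proof.
move=> H.
have cv (g : C -> R) : {morph g : x y / x - y} ->
    (forall z, `|g z| <= normc z) -> cvg ((fun x => g (f x)) @ F).
  move=> gB gb; apply/cauchy_cvgP; apply: cauchy_exP => e e0.
  have [l Hl] := H e e0; exists (g l).
  rewrite /fmap /=; near=> x => /=.
  rewrite -ball_normE /ball_ /= -gB.
  apply: le_lt_trans (gb _) _; near: x; exact: Hl.
have /cvg_ex[a /cvgrPdist_lt Ha] : cvg ((fun x => complex.Re (f x)) @ F).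
  apply: (cv (fun z => complex.Re z)) => [[? ?] [? ?]|z] //.
  exact: Re_le_normc.
have /cvg_ex[b /cvgrPdist_lt Hb] : cvg ((fun x => complex.Im (f x)) @ F).
  apply: (cv (fun z => complex.Im z)) => [[? ?] [? ?]|z] //.
  exact: Im_le_normc.
exists (a +i* b); apply/cvgc_distP => e e0.
have e20 : 0 < e / 2 by rewrite divr_gt0.
near=> x; apply: le_lt_trans (normc_le_ReDIm _) _.
rewrite [e]splitr; apply: ltrD.
  have -> : complex.Re ((a +i* b) - f x) = a - complex.Re (f x) by case: (f x).
  by near: x; exact: Ha.
have -> : complex.Im ((a +i* b) - f x) = b - complex.Im (f x) by case: (f x).
by near: x; exact: Hb.
Unshelve. all: by end_near. Qed.
End ComplexNorm.

(** * The calculus of jet bounds *)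

Section Jets.
Variable R : realType.
Local Notation C := (R[i]^o).

Definition jet_le (f : C -> C) (w : C) (m : R) : Prop :=
  exists f0 f1 : C, exists c : R, [/\ 0 <= c, normc f0 + normc f1 + c <= m &
    forall h : C, normc h <= 1 ->
      normc (f (w + h) - f0 - f1 * h) <= c * normc h ^+ 2].

Lemma jet_leW f w m m' : m <= m' -> jet_le f w m -> jet_le f w m'.
Proof.
move=> mm' [f0 [f1 [c [c0 lem H]]]]; exists f0, f1, c; split=> //.
exact: le_trans mm'.
Qed.

Lemma jet_le_eq (f g : C -> C) w m :
  (forall h, normc h <= 1 -> f (w + h) = g (w + h)) ->
  jet_le f w m -> jet_le g w m.
Proof.
move=> fg [f0 [f1 [c [c0 lem H]]]]; exists f0, f1, c; split=> // h h1.
by rewrite -fg //; exact: H.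
Qed.

Lemma jet_le_shift (f : C -> C) a w m :
  jet_le f (w + a) m -> jet_le (fun z => f (z + a)) w m.
Proof.
move=> [f0 [f1 [c [c0 lem H]]]]; exists f0, f1, c; split=> // h h1.
by rewrite [w + h + a]addrAC; exact: H.
Qed.

Lemma jet_le_ge0 f w m : jet_le f w m -> 0 <= m.
Proof.
move=> [f0 [f1 [c [c0 lem _]]]]; apply: le_trans lem.
by rewrite !addr_ge0 ?normc_ge0.
Qed.

Lemma jet_le_cst (a : C) w : jet_le (fun=> a) w (normc a).
Proof.
exists a, 0, 0; split=> // [|h _]; first by rewrite normc0 !addr0.
by rewrite subrr mul0r subr0 normc0 mul0r.
Qed.

Lemma jet_le_norm f w m (h : C) :
  jet_le f w m -> normc h <= 1 -> normc (f (w + h)) <= m.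
Proof.
move=> [f0 [f1 [c [c0 lem H]]]] h1; apply: le_trans lem.
rewrite -[f _](subrK f0) -[_ - f0](subrK (f1 * h)).
apply: le_trans (le_normcD _ _) _; rewrite [leLHS]addrC.
rewrite -[leRHS]addrA lerD2l; apply: le_trans (le_normcD _ _) _.
rewrite [leLHS]addrC lerD //.
  by rewrite normcM ler_piMr ?normc_ge0.
apply: le_trans (H _ h1) _.
by rewrite ler_piMr // expr_le1 ?normc_ge0.
Qed.

Lemma jet_leD f g w a b :
  jet_le f w a -> jet_le g w b -> jet_le (fun z => f z + g z) w (a + b).
Proof.
move=> [f0 [f1 [c [c0 lea Hf]]]] [g0 [g1 [d [d0 leb Hg]]]].
exists (f0 + g0), (f1 + g1), (c + d); split; first exact: addr_ge0.
  have := le_normcD f0 g0; have := le_normcD f1 g1.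
  by move: lea leb; lra.
move=> h h1.
have -> : f (w + h) + g (w + h) - (f0 + g0) - (f1 + g1) * h =
  (f (w + h) - f0 - f1 * h) + (g (w + h) - g0 - g1 * h) by ring.
rewrite mulrDl; apply: le_trans (le_normcD _ _) _.
by apply: lerD; [exact: Hf|exact: Hg].
Qed.

Lemma jet_leM f g w a b :
  jet_le f w a -> jet_le g w b -> jet_le (fun z => f z * g z) w (a * b).
Proof.
move=> [f0 [f1 [c [c0 lea Hf]]]] [g0 [g1 [d [d0 leb Hg]]]].
have F0 := normc_ge0 f0; have F1 := normc_ge0 f1.
have G0 := normc_ge0 g0; have G1 := normc_ge0 g1.
exists (f0 * g0), (f0 * g1 + f1 * g0),
  (normc f0 * d + normc g0 * c + normc f1 * normc g1 + normc f1 * d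
   + normc g1 * c + c * d); split.
- by rewrite !addr_ge0 // mulr_ge0.
- have := le_normcD (f0 * g1) (f1 * g0); rewrite !normcM => H.
  have : (normc f0 + normc f1 + c) * (normc g0 + normc g1 + d) <= a * b.
    by apply: ler_pM => //; rewrite !addr_ge0.
  by move: H; lra.
move=> h h1.
have := Hf _ h1; have := Hg _ h1.
set u := f _ - _ - _; set v := g _ - _ - _ => leu lev.
have -> : f (w + h) * g (w + h) - f0 * g0 - (f0 * g1 + f1 * g0) * h =
   f0 * v + g0 * u + f1 * g1 * h ^+ 2 + f1 * h * v + g1 * h * u + u * v.
  by rewrite /u /v; ring.
clearbody u v.
have h0 := normc_ge0 h; set t := normc h in h0 h1 leu lev *.
have u0 := normc_ge0 u; have v0 := normc_ge0 v.
have t2 : 0 <= t ^+ 2 by rewrite sqr_ge0.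
have t21 : t ^+ 2 <= 1 by rewrite expr_le1.
apply: (@le_trans _ _ (normc (f0 * v) + normc (g0 * u)
    + normc (f1 * g1 * h ^+ 2) + normc (f1 * h * v) + normc (g1 * h * u)
    + normc (u * v))).
  by do 5 (apply: le_trans (le_normcD _ _) _; rewrite lerD2r).
rewrite !mulrDl; apply: lerD;
  [apply: lerD; [apply: lerD; [apply: lerD; [apply: lerD|]|]|]|].
- by rewrite normcM -mulrA ler_wpM2l.
- by rewrite normcM -mulrA ler_wpM2l.
- by rewrite expr2 !normcM -/t.
- rewrite !normcM -/t -!mulrA ler_wpM2l //.
  by apply: le_trans leu; rewrite ler_piMl.
- rewrite !normcM -/t -!mulrA ler_wpM2l //.
  by apply: le_trans lev; rewrite ler_piMl.
rewrite normcM; apply: le_trans (ler_pM u0 v0 lev leu) _.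
rewrite mulrACA ler_wpM2l ?mulr_ge0 //.
by rewrite ler_piMr.
Qed.

Lemma jet_le_mul1 f g w a b :
  jet_le (fun z => f z - 1) w a -> jet_le (fun z => g z - 1) w b ->
  jet_le (fun z => f z * g z - 1) w ((1 + a) * (1 + b) - 1).
Proof.
move=> Hf Hg; have := jet_leD (jet_leD Hf Hg) (jet_leM Hf Hg).
have -> : (fun z => f z - 1 + (g z - 1) + (f z - 1) * (g z - 1)) =
   (fun z => f z * g z - 1) by apply/funext => z; ring.
by apply: jet_leW; lra.
Qed.

Lemma jet_le_prod1 (I : choiceType) (f : I -> C -> C) w (m : I -> R)
  (r : seq I) :
  (forall i, jet_le (fun z => f i z - 1) w (m i)) ->
  jet_le (fun z => \prod_(i <- r) f i z - 1) w (\prod_(i <- r) (1 + m i) - 1).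
Proof.
move=> H; elim: r => [|i r IH].
  rewrite big_nil subrr -[X in jet_le _ _ X](@normc0 R).
  have -> : (fun z => \prod_(i <- [::]) f i z - 1) = (fun=> 0).
    by apply/funext => z; rewrite big_nil subrr.
  exact: jet_le_cst.
under eq_fun do rewrite big_cons.
rewrite big_cons.
have := jet_le_mul1 (H i) IH.
by rewrite [1 + (_ - 1)]addrC subrK.
Qed.

(** On the disc |1 + f| >= 1/2, so all inverses have modulus at most 2. The constant is 26 = 2 + 4 +
    20, for value, slope and remainder. *)
Lemma jet_le_inv1 f w m : m <= 1 / 2 -> jet_le f w m ->
  jet_le (fun z => (1 + f z)^-1 - 1) w (26 * m).
Proof.
move=> m2 Hf.
have fm := jet_le_norm Hf; have m0 := jet_le_ge0 Hf.
move: Hf => [f0 [f1 [c [c0 lem H]]]].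
have F0 := normc_ge0 f0; have F1 := normc_ge0 f1.
have half (x : C) : normc x <= m -> 1 / 2 <= normc (1 + x).
  move=> xm; have : normc (1 + x - x) <= normc (1 + x) + normc x.
    by apply: le_trans (le_normcD _ _) _; rewrite normcN.
  by rewrite addrK normc1; lra.
have nz (x : C) : 1 / 2 <= normc x -> x != 0.
  by move=> le; apply/eqP => x0; move: le; rewrite x0 normc0; lra.
have hf0 : 1 / 2 <= normc (1 + f0) by apply: half; lra.
have n0 := nz _ hf0.
have iv (x : C) : 1 / 2 <= normc x -> normc x^-1 <= 2.
  move=> le; rewrite normcV; have x0 : 0 < normc x by lra.
  by rewrite -[2]invrK lef_pV2 ?posrE ?invr_gt0 //; lra.
have if0 := iv _ hf0.
have if00 := normc_ge0 (1 + f0)^-1.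
exists ((1 + f0)^-1 - 1), (- f1 * (1 + f0)^-1 ^+ 2), (20 * m); split.
- lra.
- have -> : (1 + f0)^-1 - 1 = - f0 * (1 + f0)^-1 by field.
  rewrite !expr2 !normcM !normcN.
  have : normc f0 * normc (1 + f0)^-1 <= m * 2 by apply: ler_pM => //; lra.
  have : normc f1 * (normc (1 + f0)^-1 * normc (1 + f0)^-1) <= m * (2 * 2).
    apply: ler_pM => //; rewrite ?mulr_ge0 //; first lra.
    exact: ler_pM.
  lra.
move=> h h1.
have hf : 1 / 2 <= normc (1 + f (w + h)) by apply/half/fm.
have n1 := nz _ hf; have if1 := iv _ hf.
have := H _ h1; set u := f _ - _ - _ => leu.
have -> : (1 + f (w + h))^-1 - 1 - ((1 + f0)^-1 - 1)
    - - f1 * (1 + f0)^-1 ^+ 2 * h =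
   (f1 ^+ 2 * h ^+ 2 + f1 * h * u - (1 + f0) * u)
    * ((1 + f (w + h))^-1 * (1 + f0)^-1 ^+ 2).
  by rewrite /u; field; rewrite n0 n1.
have h0 := normc_ge0 h; set t := normc h in h0 h1 leu *.
have u0 := normc_ge0 u.
have t2 : 0 <= t ^+ 2 by rewrite sqr_ge0.
rewrite normcM.
(* The numerator contributes 5/2 = 1/2 + 1/2 + 3/2, one summand per term, and the three inverses
   contribute 8. *)
have -> : 20 * m * t ^+ 2 = (5 / 2) * m * t ^+ 2 * (2 * 2 ^+ 2) by field.
apply: ler_pM; rewrite ?normc_ge0 //; last first.
  rewrite normcM; apply: ler_pM; rewrite ?normc_ge0 //.
  by rewrite !expr2 normcM; apply: ler_pM; rewrite ?normc_ge0.
have um : normc u <= m * t ^+ 2.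
  by apply: le_trans leu _; rewrite ler_wpM2r //; lra.
apply: (@le_trans _ _ ((1 / 2) * m * t ^+ 2 + (1 / 2) * (m * t ^+ 2) +
    (3 / 2) * (m * t ^+ 2))); last by lra.
apply: le_trans (le_normcD _ _) _; rewrite normcN; apply: lerD.
  apply: le_trans (le_normcD _ _) _; apply: lerD.
    rewrite normcM; apply: ler_pM; rewrite ?normc_ge0 //; last first.
      by rewrite expr2 normcM.
    rewrite expr2 normcM; apply: ler_pM; rewrite ?normc_ge0 //; lra.
  rewrite normcM; apply: ler_pM; rewrite ?normc_ge0 //.
  rewrite normcM -[1/2]mulr1; apply: ler_pM; rewrite ?normc_ge0 //; lra.
rewrite normcM; apply: ler_pM; rewrite ?normc_ge0 //.
by apply: le_trans (le_normcD _ _) _; rewrite normc1; lra.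
Qed.

End Jets.

(** * Differentiability from jets, and jets of pointwise limits *)

Section JetLimits.
Variable R : realType.
Local Notation C := (R[i]^o).

(* Unification does not find the structure of R[i]^o over R[i] by itself when
   cvgB or cvgM is applied. *)
Lemma cvgcB T (F : set_system T) (FF : Filter F) (f g : T -> C) (a b : C) :
  f @ F --> a -> g @ F --> b -> (fun x => f x - g x) @ F --> a - b.
Proof. exact: (@cvgB R[i] C T F FF f g a b). Qed.

Lemma cvgcM T (F : set_system T) (FF : Filter F) (f g : T -> C) (a b : C) :
  f @ F --> a -> g @ F --> b -> (fun x => f x * g x) @ F --> a * b.
Proof. exact: (@cvgM R[i] T F FF f g a b). Qed.

Lemma normc_cvg T (F : set_system T) (FF : Filter F) (f : T -> C) (l : C) :
  f @ F --> l -> (fun x => normc (f x)) @ F --> normc l.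
Proof.
move=> /cvgc_distP H; apply/cvgrPdist_lt => e e0.
have := H _ e0; apply: filterS => x; apply: le_lt_trans.
have A := le_normcD (l - f x) (f x); have B := le_normcD (f x - l) l.
rewrite !subrK in A B; rewrite [normc (f x - l)]normcB in B.
by rewrite ler_norml; apply/andP; split; lra.
Qed.

Lemma jet_le_derivable (f : C -> C) w m : jet_le f w m -> derivable f w 1.
Proof.
move=> [f0 [f1 [c [c0 lem H]]]].
have f0E : f0 = f w.
  have := H 0; rewrite normc0 ler01 => /(_ isT).
  rewrite addr0 mulr0 subr0 expr0n mulr0 => H0.
  apply/esym/eqP; rewrite -subr_eq0; apply/eqP/eq0_normc/eqP.
  by rewrite eq_le H0 normc_ge0.
apply/cvg_ex; exists f1; apply/cvgc_distP => e e0.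
have d0 : 0 < Num.min 1 (e / (c + 1)).
  by rewrite lt_min ltr01 divr_gt0 // ltr_wpDl.
near=> h.
have hn0 : h != 0 by near: h; exact: nbhs_dnbhs_neq.
have hd : normc (h : C) < Num.min 1 (e / (c + 1)).
  near: h; apply: nbhs_dnbhs.
  have : (fun x : C => x) @ nbhs (0 : C) --> (0 : C) by exact: cvg_id.
  by move=> /cvgc_distP /(_ _ d0); apply: filterS => x; rewrite sub0r normcN.
move: hd; rewrite lt_min => /andP[h1 he].
have := H h (ltW h1).
have nh0 : 0 < normc (h : C) := normc_gt0 hn0.
have -> : f1 - h^-1 *: (f (h *: (1 : C) + w) - f w) =
    - h^-1 * (f (w + h) - f0 - f1 * h).
  rewrite f0E [h *: 1]mulr1 [h + w]addrC -[_ *: _]/(h^-1 * _).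
  by field.
move=> le; rewrite normcM normcN normcV mulrC ltr_pdivrMr //.
apply: le_lt_trans le _.
rewrite expr2 mulrA ltr_pM2r //.
apply: (@le_lt_trans _ _ (c * (e / (c + 1)))).
  by rewrite ler_wpM2l // ltW.
rewrite mulrCA gtr_pMr // ltr_pdivrMr; lra.
Unshelve. all: by end_near. Qed.

Lemma jet_le_lim T (F : set_system T) (FF : ProperFilter F)
  (f : T -> C -> C) (g : C -> C) (w : C) (m : R) :
  (forall k, jet_le (f k) w m) ->
  (forall h, normc h <= 1 -> (f k (w + h)) @[k --> F] --> g (w + h)) ->
  jet_le g w m.
Proof.
move=> Hf Hg.
have [f0 Hf0] := choice Hf; have {Hf0}[f1 Hf1] := choice Hf0.
have {Hf1}[c Hc] := choice Hf1.
have c0 k : 0 <= c k by have [] := Hc k.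
have lem k : normc (f0 k) + normc (f1 k) + c k <= m by have [] := Hc k.
have H k h : normc h <= 1 ->
    normc (f k (w + h) - f0 k - f1 k * h) <= c k * normc h ^+ 2.
  by have [_ _] := Hc k; apply.
have n0 : normc (0 : C) <= 1 by rewrite normc0.
have cm k : c k <= m.
  by have := lem k; have := normc_ge0 (f0 k); have := normc_ge0 (f1 k); lra.
have f0E k : f0 k = f k (w + 0).
  have := H k 0 n0; rewrite normc0 mulr0 subr0 expr0n mulr0 => H0.
  apply/esym/eqP; rewrite -subr_eq0; apply/eqP/eq0_normc/eqP.
  by rewrite eq_le H0 normc_ge0.
have cf0 : f0 @ F --> g (w + 0).
  by rewrite (funext f0E); exact: Hg.
have m0 : 0 <= m.
  by have [k _] := filter_ex (@filterT _ F _); apply: le_trans (cm k).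
have quot k h : normc h <= 1 -> h != 0 ->
    normc ((f k (w + h) - f0 k) / h - f1 k) <= m * normc h.
  move=> h1 hn0.
  have nh0 : 0 < normc (h : C) := normc_gt0 hn0.
  have -> : (f k (w + h) - f0 k) / h - f1 k =
     (f k (w + h) - f0 k - f1 k * h) / h by field.
  rewrite normcM normcV ler_pdivrMr //; apply: le_trans (H k h h1) _.
  by rewrite -mulrA -expr2 ler_wpM2r // sqr_ge0.
(* The difference quotient at a fixed small h converges along F and is within
   m |h| of f1 k, so f1 is Cauchy along F. *)
have [g1 cf1] : exists g1 : C, f1 @ F --> g1.
  apply: complexc_cauchy => e e0.
  have d0 : 0 < Num.min 1 (e / (2 * (m + 1))).
    by rewrite lt_min ltr01 divr_gt0 // mulr_gt0 // ltr_wpDl.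
  set d := Num.min _ _ in d0; pose h : C := d%:C.
  have nh : normc h = d by rewrite normc_real ger0_norm // ltW.
  have h1 : normc h <= 1 by rewrite nh ge_min lexx.
  have hn0 : h != 0 by apply/eqP => hE; move: d0; rewrite -nh hE normc0 ltxx.
  exists ((g (w + h) - g (w + 0)) / h).
  have : (fun k => (f k (w + h) - f0 k) / h) @ F -->
      (g (w + h) - g (w + 0)) / h.
    by refine (cvgcM _ (cvgcB _ _ cf0) _); [exact: Hg | exact: cvg_cst].
  move=> /cvgc_distP /(_ (e / 2)); rewrite divr_gt0 // => /(_ isT).
  apply: filterS => k Hk.
  set A := (g _ - _) / h in Hk *; set B := (f k _ - _) / h in Hk *.
  have -> : A - f1 k = (A - B) + (B - f1 k) by ring.
  apply: le_lt_trans (le_normcD _ _) _.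
  have := quot k h h1 hn0; rewrite -/B nh => leB.
  have dm : d <= e / (2 * (m + 1)) by rewrite ge_min lexx orbT.
  have : m * d <= e / 2.
    apply: (@le_trans _ _ (m * (e / (2 * (m + 1))))).
      by rewrite ler_wpM2l.
    have -> : m * (e / (2 * (m + 1))) = (e / 2) * (m / (m + 1)).
      by field; rewrite lt0r_neq0 // ltr_wpDl.
    by rewrite ger_pMr ?divr_gt0 // ler_pdivrMr ?ltr_wpDl // mul1r; lra.
  lra.
have cn0 := normc_cvg _ cf0; have cn1 := normc_cvg _ cf1.
have cS : (fun k => m - normc (f0 k) - normc (f1 k)) @ F -->
     m - normc (g (w + 0)) - normc g1.
  by apply: cvgB; [apply: cvgB; [exact: cvg_cst|exact: cn0]|exact: cn1].
(* The remainder constants [c k] are not known to converge; their upper bounds m - |f0 k| - |f1 k|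
   do. *)
exists (g (w + 0)), g1, (m - normc (g (w + 0)) - normc g1); split.
- apply: (cvgr_to_ge cS); apply: nearW => k.
  by have := lem k; have := c0 k; lra.
- by lra.
move=> h h1.
have cL : (fun k => normc (f k (w + h) - f0 k - f1 k * h)) @ F -->
    normc (g (w + h) - g (w + 0) - g1 * h).
  apply: normc_cvg; refine (cvgcB _ (cvgcB _ _ cf0) (cvgcM _ cf1 _)).
    exact: Hg.
  exact: cvg_cst.
have cR : (fun k => (m - normc (f0 k) - normc (f1 k)) * normc h ^+ 2) @ F -->
    (m - normc (g (w + 0)) - normc g1) * normc h ^+ 2.
  by apply: cvgM; [exact: cS|exact: cvg_cst].
rewrite -subr_ge0; apply: (cvgr_to_ge (cvgB cR cL)); apply: nearW => k.
rewrite subr_ge0.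
apply: le_trans (H k h h1) _; apply: ler_wpM2r; first exact: sqr_ge0.
by have := lem k; lra.
Qed.
End JetLimits.

(** * Infinite products over nets of finite sets *)

Section NetProducts.
Variable R : realType.
Local Notation C := (R[i]^o).

Lemma prod_one_add_le (I : choiceType) (m : I -> R) (r : seq I) :
  (forall i, 0 <= m i) -> \sum_(i <- r) m i <= 1 / 2 ->
  \prod_(i <- r) (1 + m i) <= 1 + 2 * \sum_(i <- r) m i.
Proof.
move=> m0 S2.
(* With s the sum, this bounds the product by 1/(1 - s), which is at most 1 + 2 s when s <= 1/2. *)
have : \prod_(i <- r) (1 + m i) * (1 - \sum_(i <- r) m i) <= 1.
  elim: r S2 => [|i r IH]; first by rewrite !big_nil subr0 mulr1.
  rewrite !big_cons => S2; have := m0 i => mi0.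
  have s0 : 0 <= \sum_(j <- r) m j by rewrite sumr_ge0.
  have S1 : \sum_(j <- r) m j <= 1 / 2 by lra.
  apply: le_trans (IH S1).
  rewrite [1 + m i]addrC mulrDl mul1r.
  set P := \prod_(j <- r) _; have P0 : 0 <= P.
    by apply: prodr_ge0 => j _; rewrite addr_ge0.
  rewrite -subr_ge0.
  have -> : P * (1 - \sum_(j <- r) m j) -
      (m i * P + P) * (1 - (m i + \sum_(j <- r) m j)) =
      P * (m i * (m i + \sum_(j <- r) m j)) by ring.
  by rewrite mulr_ge0 // mulr_ge0 // addr_ge0.
have s0 : 0 <= \sum_(j <- r) m j by rewrite sumr_ge0.
set P := \prod_(j <- r) _; have P0 : 0 <= P.
  by apply: prodr_ge0 => j _; rewrite addr_ge0.
move: s0 S2; set s := \sum_(j <- r) _ => s0 S2 H.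
rewrite -(ler_pM2r (_ : 0 < 1 - s)); last by lra.
apply: le_trans H _; rewrite -subr_ge0.
have -> : (1 + 2 * s) * (1 - s) - 1 = s * (1 - 2 * s) by ring.
by rewrite mulr_ge0 //; lra.
Qed.

Lemma fset_prod_split (I : choiceType) (A : comNzRingType) (a : I -> A)
  (J K : {fset I}) : (J `<=` K)%fset ->
  \prod_(i <- K) a i = \prod_(i <- J) a i * \prod_(i <- (K `\` J)%fset) a i.
Proof.
move=> JK; rewrite -big_cat; apply: perm_big; apply: uniq_perm.
- exact: fset_uniq.
- rewrite cat_uniq !fset_uniq andbT /=; apply/hasPn => x.
  by rewrite in_fsetD => /andP[].
move=> x; rewrite mem_cat in_fsetD.
have [xJ|//] := boolP (x \in J).
by rewrite (fsubsetP JK _ xJ).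
Qed.

(** The products of the 1 + m_i increase with the finite set and are bounded, so some J comes within
    e of their supremum. For K containing J, the products of the a_i over J and K differ by at most
    the difference of these majorants. *)
Lemma cvg_net_prod (I : choiceType) (a : I -> C) (m : I -> R) (M : R) :
  (forall i, normc (a i - 1) <= m i) ->
  (forall J : {fset I}, \prod_(i <- J) (1 + m i) <= M) ->
  exists l : C, (fun J : {fset I} => \prod_(i <- J) a i) @ totally --> l.
Proof.
move=> am HM.
have m0 i : 0 <= m i by apply: le_trans (am i); exact: normc_ge0.
have prod_sub1 (r : seq I) :
    normc (\prod_(i <- r) a i - 1) <= \prod_(i <- r) (1 + m i) - 1.
  (* Viewing each [a i] as a constant function lets the jet bound for products give the numerical
     one. *)
  have /jet_le_prod1 H : forall i, jet_le (fun z => (fun=> a i) z - 1) 0 (m i).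
    by move=> i; apply: jet_leW (am i) _; exact: jet_le_cst.
  by have := jet_le_norm (H r) (_ : normc 0 <= 1); apply; rewrite normc0.
have P1 (J : {fset I}) : 1 <= \prod_(i <- J) (1 + m i).
  have := le_trans (normc_ge0 _) (prod_sub1 J); lra.
pose Q := [set x : R | exists J : {fset I}, x = \prod_(i <- J) (1 + m i)].
have Qsup : has_sup Q.
  split; first by exists (\prod_(i <- fset0) (1 + m i)); exists fset0.
  by exists M => _ [J ->].
apply: complexc_cauchy => e e0.
have [_ [J ->] HJ] := sup_adherent e0 Qsup.
exists (\prod_(i <- J) a i); exists J => // K /= JK.
rewrite normcB (fset_prod_split _ JK) -[X in _ - X]mulr1 -mulrBr normcM.
have nJ : normc (\prod_(i <- J) a i) <= \prod_(i <- J) (1 + m i).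
  have -> : \prod_(i <- J) a i = (\prod_(i <- J) a i - 1) + 1 by rewrite subrK.
  by apply: le_trans (le_normcD _ _) _; rewrite normc1 -lerBrDr.
apply: le_lt_trans (ler_pM (normc_ge0 _) (normc_ge0 _) nJ (prod_sub1 _)) _.
rewrite mulrBr mulr1 -(fset_prod_split _ JK).
have : \prod_(i <- K) (1 + m i) <= sup Q.
  by apply: ub_le_sup; [case: Qsup|exists K].
by move: HJ; lra.
Qed.

(** This serves twice: for the Euler product over the primes, and for the product of the shifts L(s
    + j). *)
Lemma jet_le_net_prod (I : choiceType) (f : I -> C -> C) w (m : I -> R)
  (S : R) :
  S <= 1 / 2 -> (forall J : {fset I}, \sum_(i <- J) m i <= S) ->
  (forall i, jet_le (fun z => f i z - 1) w (m i)) ->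
  (forall h, normc h <= 1 ->
    cvg ((fun J : {fset I} => \prod_(i <- J) f i (w + h)) @ totally)) /\
  jet_le (fun z =>
      lim ((fun J : {fset I} => \prod_(i <- J) f i z) @ totally) - 1) w (2 * S).
Proof.
move=> S2 HS Hf.
have m0 i := jet_le_ge0 (Hf i).
have HM (J : {fset I}) : \prod_(i <- J) (1 + m i) <= 1 + 2 * S.
  apply: le_trans (prod_one_add_le m0 _) _; first exact: le_trans (HS J) _.
  by have := HS J; lra.
have cv h : normc h <= 1 ->
    cvg ((fun J : {fset I} => \prod_(i <- J) f i (w + h)) @ totally).
  move=> h1; apply/cvg_ex; apply: (@cvg_net_prod _ _ m _ _ HM) => i.
  exact: jet_le_norm (Hf i) h1.
split=> //.
apply: (@jet_le_lim _ _ totally _ (fun J z => \prod_(i <- J) f i z - 1)).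
  move=> J; apply: jet_leW (jet_le_prod1 _ Hf).
  by have := HM J; lra.
move=> h h1; apply: cvgcB; [exact: cv | exact: cvg_cst].
Qed.
End NetProducts.

(** * The complex exponential and the jet of N^(-s) *)

Section ComplexExp.
Variable R : realType.
Local Notation C := (R[i]^o).

(** Each trigonometric bound below follows from a bound on the derivative, for either sign of x. *)
Lemma mvt_from0 (f df : R -> R) (x : R) :
  (forall y, is_derive y (1 : R) f (df y)) -> f 0 = 0 ->
  exists2 c, `|c| <= `|x| & f x = df c * x.
Proof.
move=> Hf f0.
have fc a b : {within `[a, b], continuous f}%classic.
  apply: derivable_within_continuous => y _.
  by have [] := Hf y.
have [x0|x0] := leP 0 x.
- have [c] := MVT_segment x0 (fun y _ => Hf y) (fc _ _).
  rewrite in_itv /= => /andP[c0 cx]; rewrite f0 !subr0 => ->; exists c => //.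
  by rewrite !ger0_norm.
- have [c] := MVT_segment (ltW x0) (fun y _ => Hf y) (fc _ _).
  rewrite in_itv /= => /andP[c0 cx]; rewrite f0 !sub0r mulrN => /oppr_inj ->.
  by exists c => //; rewrite !ler0_norm ?lerN2 // ltW.
Qed.

Lemma sin_le_id (x : R) : `|sin x| <= `|x|.
Proof.
have [c _ ->] := mvt_from0 x (@is_derive_sin R) (sin0 R).
by rewrite normrM ler_piMl // ler_norml cos_geN1 cos_le1.
Qed.

Lemma one_sub_cos_le (x : R) : `|1 - cos x| <= `|x| ^+ 2.
Proof.
have [||c cx ->] := @mvt_from0 (fun y => 1 - cos y) sin x.
- by move=> y; apply: is_derive_eq; rewrite add0r mul1r opprK.
- by rewrite cos0 subrr.
rewrite normrM expr2 ler_wpM2r //.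
exact: le_trans (sin_le_id c) cx.
Qed.

Lemma one_sub_cos_le1 (x : R) : `|1 - cos x| <= `|x|.
Proof.
have [||c cx ->] := @mvt_from0 (fun y => 1 - cos y) sin x.
- by move=> y; apply: is_derive_eq; rewrite add0r mul1r opprK.
- by rewrite cos0 subrr.
by rewrite normrM ler_piMl // ler_norml sin_geN1 sin_le1.
Qed.

Lemma id_sub_sin_le (x : R) : `|x - sin x| <= `|x| ^+ 2.
Proof.
have [|c cx ->] := @mvt_from0 (fun y => y - sin y) (fun y => 1 - cos y) x.
- by rewrite sin0 subrr.
rewrite normrM expr2 ler_wpM2r //.
exact: le_trans (one_sub_cos_le1 c) cx.
Qed.

Lemma expR_sub1_le (x : R) : `|expR x - 1| <= `|x| * expR `|x|.
Proof.
have e0 := expR_gt0 x; have := expR_ge1Dx x; have := expR_ge1Dx (- x).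
have [x0|x0] := leP 0 x.
  move=> H1 H2; rewrite (ger0_norm x0) ger0_norm; last by lra.
  have : (1 - x) * expR x <= 1.
    by rewrite -[leRHS](expRxMexpNx_1 x) mulrC ler_pM2l.
  lra.
move=> _ H2; rewrite (ltr0_norm x0) ltr0_norm; last first.
  by rewrite subr_lt0 expR_lt1.
have := expR_ge1Dx (- x) => H3.
apply: (@le_trans _ _ (- x)); first lra.
by rewrite ler_peMr ?oppr_ge0 ?ltW //; lra.
Qed.

Lemma expR_sub1_sub_le (x : R) : `|expR x - 1 - x| <= `|x| ^+ 2 * expR `|x|.
Proof.
have e0 := expR_gt0 x; have H2 := expR_ge1Dx x; have H1 := expR_ge1Dx (- x).
have H : (1 - x) * expR x <= 1.
  by rewrite -[leRHS](expRxMexpNx_1 x) mulrC ler_pM2l.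
rewrite ger0_norm; last by lra.
apply: (@le_trans _ _ (x * (expR x - 1))); first by lra.
apply: le_trans (ler_norm _) _; rewrite normrM expr2 -mulrA ler_wpM2l //.
exact: expR_sub1_le.
Qed.

Lemma cexpE (a b : R) : cexp (a +i* b) = (expR a * cos b) +i* (expR a * sin b).
Proof.
rewrite /cexp /=; apply/eqP.
by rewrite eq_complex /= !mul0r subr0 addr0 !eqxx.
Qed.

Lemma cexpD (z w : C) : cexp (z + w) = cexp z * cexp w.
Proof.
case: z w => a b [c d]; rewrite -[_ + _]/((a + c) +i* (b + d)) !cexpE.
apply/eqP; rewrite eq_complex /= expRD cosD sinD.
by apply/andP; split; apply/eqP; ring.
Qed.

Lemma normc_cexp (z : C) : normc (cexp z) = expR (complex.Re z).
Proof.
case: z => a b; rewrite cexpE /= !exprMn -mulrDr cos2Dsin2 mulr1.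
by rewrite sqrtr_sqr ger0_norm // expR_ge0.
Qed.

(** Real and imaginary parts split into two terms each, and each of the four is at most |z|^2 exp
    |z|. *)
Lemma cexp_sub1_sub_le (z : C) :
  normc (cexp z - 1 - z) <= 4 * expR (normc z) * normc z ^+ 2.
Proof.
case: z => a b; set z := a +i* b.
have ra : `|a| <= normc z by exact: Re_le_normc z.
have rb : `|b| <= normc z by exact: Im_le_normc z.
have N0 := normc_ge0 z; set N := normc z in ra rb N0 *; rewrite /z.
have -> : cexp (a +i* b) - 1 - (a +i* b) =
    ((expR a * (cos b - 1))+ (expR a - 1 - a)) +i*
      (expR a * (sin b - b) + b * (expR a - 1)).
  rewrite cexpE; apply/eqP; rewrite eq_complex /=.
  by apply/andP; split; apply/eqP; ring.
apply: le_trans (normc_le_ReDIm _) _ => /=.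
have ea : expR a <= expR N by rewrite ler_expR (le_trans (ler_norm a)).
have eaa : expR `|a| <= expR N by rewrite ler_expR.
have E0 := expR_ge0 a; have E1 := expR_ge0 `|a|; have E2 := expR_ge0 N.
have b2 : `|b| ^+ 2 <= N ^+ 2 by rewrite lerXn2r ?nnegrE.
have a2 : `|a| ^+ 2 <= N ^+ 2 by rewrite lerXn2r ?nnegrE.
have -> : 4 * expR N * N ^+ 2 = (expR N * N ^+ 2 + N ^+ 2 * expR N)
   + (expR N * N ^+ 2 + N * (N * expR N)) by ring.
apply: lerD; apply: le_trans (ler_normD _ _) _; apply: lerD.
- rewrite normrM (ger0_norm E0) distrC; apply: ler_pM => //.
  exact: le_trans (one_sub_cos_le b) _.
- by apply: le_trans (expR_sub1_sub_le a) _; apply: ler_pM => //.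
- rewrite normrM (ger0_norm E0) distrC; apply: ler_pM => //.
  exact: le_trans (id_sub_sin_le b) _.
- rewrite normrM; apply: ler_pM => //.
  by apply: le_trans (expR_sub1_le a) _; apply: ler_pM.
Qed.

(** The jet at w is N^(-w) times that of exp(- h log N), whose remainder constant is at most 4 N^3
    since log N <= N. The total 1 + log N + 4 N^3 is at most 6 N^3. Of the exponent j + 5, three
    powers of N absorb N^3, two remain as N^(-2), and N^(-j) <= 2^(-j). *)
Lemma jet_le_nat_cpow (N j : nat) (w : C) :
  (1 < N)%N -> (j + 5)%:R <= complex.Re w ->
  jet_le (fun s => nat_cpow N (- s)) w (6 * (N%:R ^+ 2)^-1 * (2 ^+ j)^-1).
Proof.
move=> N1 wj.
have N1R : 2 <= N%:R :> R by rewrite (ler_nat R 2).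
have N0 : 0 < N%:R :> R by lra.
set l := ln (N%:R : R).
have eN : expR l = N%:R by rewrite lnK.
have lN : l <= N%:R by rewrite -eN; apply: le_trans (expR_ge1Dx l); lra.
have l0 : 0 <= l by apply: ln_ge0; lra.
pose x0 : C := nat_cpow N (- w).
have nx0 : normc x0 <= (N%:R ^+ (j + 5))^-1.
  rewrite normc_cexp.
  have -> : complex.Re (- w * l%:C) = - (complex.Re w * l).
    by case: (w) => a b /=; rewrite mulr0 subr0 mulNr.
  rewrite -eN -expRM_natl -expRN ler_expR lerN2 ler_wpM2r //.
exists x0, (- (l%:C) * x0), (normc x0 * (4 * N%:R ^+ 3)).
have X0 := normc_ge0 x0.
split.
- by rewrite !mulr_ge0 // exprn_ge0 // ltW.
- rewrite [normc (- (l%:C) * x0)]normcM normcN normc_real ger0_norm //.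
  have N31 : N%:R <= N%:R ^+ 3 :> R by rewrite exprS ler_peMr ?expr_ge1 //; lra.
  apply: (@le_trans _ _ (normc x0 * (6 * N%:R ^+ 3))).
    rewrite -subr_ge0.
    have -> : normc x0 * (6 * N%:R ^+ 3) -
      (normc x0 + l * normc x0 + normc x0 * (4 * N%:R ^+ 3)) =
      normc x0 * ((N%:R ^+ 3 - 1) + (N%:R ^+ 3 - l)) by ring.
    by rewrite mulr_ge0 //; lra.
  apply: (@le_trans _ _ ((N%:R ^+ (j + 5))^-1 * (6 * N%:R ^+ 3))).
    by rewrite ler_wpM2r // mulr_ge0 // exprn_ge0 // ltW.
  have -> : (N%:R ^+ (j + 5))^-1 * (6 * N%:R ^+ 3) =
     6 * (N%:R ^+ 2)^-1 * (N%:R ^+ j)^-1 :> R.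
    rewrite -[5%N]/(2 + 3)%N 2!exprD.
    by field; rewrite !expf_neq0 ?lt0r_neq0.
  rewrite ler_wpM2l //.
  by rewrite lef_pV2 ?posrE ?exprn_gt0 // lerXn2r ?nnegrE // ltW.
move=> h h1.
have -> : nat_cpow N (- (w + h)) - x0 - - (l%:C) * x0 * h =
    x0 * (cexp (- h * l%:C) - 1 - (- h * l%:C)).
  by rewrite /x0 /nat_cpow opprD mulrDl cexpD; ring.
rewrite normcM -mulrA ler_wpM2l //.
apply: le_trans (cexp_sub1_sub_le _) _.
rewrite normcM normcN normc_real (ger0_norm l0) exprMn [in leRHS]exprSr.
have H0 := normc_ge0 h.
have -> : 4 * (N%:R ^+ 2 * N%:R) * normc h ^+ 2 =
    4 * N%:R * (normc h ^+ 2 * N%:R ^+ 2) :> R by ring.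
apply: ler_pM.
- by rewrite mulr_ge0 // expR_ge0.
- by rewrite mulr_ge0 // sqr_ge0.
- by rewrite ler_wpM2l // -eN ler_expR ler_piMl.
- by rewrite ler_wpM2l ?sqr_ge0 // lerXn2r ?nnegrE // ltW.
Qed.
End ComplexExp.

(** * Euler products *)

Section Factors.
Variable R : realType.
Local Notation C := (R[i]^o).

(** The sum of the moduli of the coefficients works as [Q], since m <= 1 bounds the higher powers of
    m by m. *)
Lemma jet_le_horner (r : {poly R[i]}) :
  exists2 Q : R, 0 <= Q & forall (x : C -> C) w m, m <= 1 -> jet_le x w m ->
    jet_le (fun z => x z * r.[x z]) w (Q * m).
Proof.
elim/poly_ind: r => [|r c [Q Q0 IH]].
  exists 0 => // x w m _ _; rewrite mul0r -[X in jet_le _ _ X](@normc0 R).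
  under eq_fun do rewrite horner0 mulr0.
  exact: jet_le_cst.
exists (Q + normc c) => [|x w m m1 Hx]; first by rewrite addr_ge0 ?normc_ge0.
have m0 := jet_le_ge0 Hx.
have := jet_leD (jet_leM Hx (IH x w m m1 Hx)) (jet_leM (jet_le_cst c w) Hx).
have -> : (fun z => x z * (x z * r.[x z]) + c * x z) =
    (fun z => x z * (r * 'X + c%:P).[x z]).
  by apply/funext => z; rewrite hornerMXaddC; ring.
apply: jet_leW; rewrite mulrDl lerD2r.
by rewrite ler_piMl // mulr_ge0.
Qed.

(** The determinant is a polynomial in x with value 1 at 0. It presents an Euler factor as the
    inverse of 1 plus a multiple of x = N(q)^(-s). *)
Lemma det_one_sub (F : fieldType) (n : nat) (M : 'M[F]_n) :
  exists r : {poly F}, forall x, \det (1%:M - x *: M) = 1 + x * r.[x].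
Proof.
pose p : {poly F} := \det (1%:M - 'X *: map_mx polyC M).
have pE x : p.[x] = \det (1%:M - x *: M).
  rewrite -horner_evalE -det_map_mx; congr (\det _); apply/matrixP => i j.
  rewrite !mxE /= horner_evalE hornerD hornerN hornerM hornerX hornerC.
  by rewrite hornerMn hornerC.
have : root (p - 1) 0.
  by rewrite /root hornerD hornerN hornerC pE scale0r subr0 det1 subrr.
move=> /factor_theorem[r rE]; exists r => x.
have := congr1 (fun q => q.[x]) rE.
rewrite hornerD hornerN hornerC pE hornerM hornerXsubC subr0.
by move=> /eqP; rewrite subr_eq => /eqP ->; rewrite addrC mulrC.
Qed.

Section Artin.
Variables (K : fieldExtType rat) (L : splittingFieldType K) (n : nat).
Variable rho : mx_representation R[i] 'Gal({:L} / 1%VS)%g n.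

(* The Euler factors are built from finitely many matrices, one for each pair
   (inertia group, Frobenius), which makes the bounds uniform in the prime. *)
Lemma jet_le_euler_factor :
  exists2 c : R, 0 <= c & exists j0, forall (q : prime_of K) (w : C) j,
    (j0 <= j)%N -> (1 < ideal_norm q)%N -> (j + 5)%:R <= complex.Re w ->
    jet_le (fun s => euler_factor rho s q - 1) w
      (c * ((ideal_norm q)%:R ^+ 2)^-1 * (2 ^+ j)^-1).
Proof.
pose T := ({set gal_of {:L}} * gal_of {:L})%type.
pose M (t : T) := restrictmx (rfix_mx rho t.1) (rho t.2).
have /choice[r Hr] : forall t : T, exists r : {poly R[i]}, forall x,
    \det (1%:M - x *: M t) = 1 + x * r.[x].
  by move=> t; exact: det_one_sub.
have /choice[Q HQ] : forall t : T, exists Q : R, 0 <= Q /\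
    forall (x : C -> C) w m, m <= 1 -> jet_le x w m ->
    jet_le (fun z => x z * (r t).[x z]) w (Q * m).
  by move=> t; have [Q] := jet_le_horner (r t); exists Q.
pose S := \sum_(t : T) Q t.
have QS t : Q t <= S.
  rewrite /S (bigD1 t) //= lerDl sumr_ge0 // => i _.
  by have [] := HQ i.
have S0 : 0 <= S by rewrite sumr_ge0 // => i _; have [] := HQ i.
(* As m <= 6 * 2^(-j), this gives (1 + S) m <= 1/2, hence both m <= 1 and the smallness required for
   inversion. *)
have [j0 Hj0] := exp2_arch (12 * (1 + S)).
exists (26 * (S * 6)); first by rewrite !mulr_ge0.
exists j0 => q w j jj0 N1 wj.
have Hx := jet_le_nat_cpow N1 wj.
set N := ideal_norm q in N1 Hx *.
pose t : T := (inertia_group (chosen_prime_above L q), frobenius L q).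
set m := 6 * _ * _ in Hx.
have m12 : 12 * (1 + S) * m <= 6.
  have NV : 0 <= ((N%:R : R) ^+ 2)^-1 <= 1.
    rewrite invr_ge0 sqr_ge0 /= invf_le1 ?exprn_gt0 ?ltr0n ?(ltnW N1) //.
    by rewrite exprn_ege1 // ler1n ltnW.
  have := Hj0 _ jj0; case/andP: NV; rewrite /m.
  set x := (_ ^+ 2)^-1; set y := (2 ^+ j)^-1 => x0 x1 H.
  have -> : 12 * (1 + S) * (6 * x * y) = 6 * (x * (12 * (1 + S) * y)) by ring.
  rewrite ger_pMr // mulr_ile1 // !mulr_ge0 //; first by rewrite addr_ge0.
  by rewrite invr_ge0 exprn_ge0.
have m0 : 0 <= m := jet_le_ge0 Hx.
have [Q0 HQt] := HQ t.
have m1 : m <= 1 by have := mulr_ge0 S0 m0; lra.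
have Qm : Q t * m <= 1 / 2.
  have : Q t * m <= S * m by rewrite ler_wpM2r.
  lra.
have := jet_le_inv1 Qm (HQt _ w m m1 Hx).
have -> : (fun z => (1 + nat_cpow N (- z) * (r t).[nat_cpow N (- z)])^-1 - 1) =
    (fun s => euler_factor rho s q - 1).
  by apply/funext => s; rewrite -Hr.
apply: jet_leW.
have -> : 26 * (S * 6) * (N%:R ^+ 2)^-1 * (2 ^+ j)^-1 = 26 * (S * m).
  by rewrite /m; ring.
by rewrite ler_wpM2l // ler_wpM2r.
Qed.

Lemma jet_le_artin_L :
  exists2 c : R, 0 <= c & exists j0, forall (w : C) j,
    (j0 <= j)%N -> (j + 5)%:R <= complex.Re w ->
    jet_le (fun s => artin_L rho s - 1) w (c * (2 ^+ j)^-1).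
Proof.
have [c c0 [j0 Hj0]] := jet_le_euler_factor.
pose D : R := (\dim {:K})%:R * 2.
have D0 : 0 <= D by rewrite mulr_ge0.
(* Makes the sum of the jet bounds over all primes at most 1/2. *)
have [j1 Hj1] := exp2_arch (2 * (c * D)).
exists (2 * (c * D)); first by rewrite !mulr_ge0.
exists (maxn j0 j1) => w j; rewrite geq_max => /andP[jj0 jj1] wj.
have [||q|_] := @jet_le_net_prod R (prime_of K)
   (fun q s => euler_factor rho s q) w
   (fun q => c * ((ideal_norm q)%:R ^+ 2)^-1 * (2 ^+ j)^-1)
   (c * D * (2 ^+ j)^-1).
- by have := Hj1 _ jj1; lra.
- move=> J; rewrite -mulr_suml -mulr_sumr ler_wpM2r ?invr_ge0 ?exprn_ge0 //.
  by rewrite ler_wpM2l // sum_ideal_norm_le.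
- by apply: Hj0 => //; exact: ideal_norm_gt1.
by rewrite !mulrA.
Qed.

(** The factor L(s + i) differs from 1 by a jet of norm at most c 2^(-i-j), a geometric series in i.
    Convergence on the whole disc is recorded because the continuation needs actual limits there. *)
Lemma artin_Ltilde_far :
  exists j0 : nat, forall w : C, j0%:R <= complex.Re w ->
    (forall h : C, normc h <= 1 ->
       cvg ((fun k : nat => \prod_(0 <= j < k) artin_L rho (w + h + j%:R))
            @ \oo))
    /\ derivable (artin_Ltilde rho) w 1.
Proof.
have [c c0 [j0 Hj0]] := jet_le_artin_L.
have [j1 Hj1] := exp2_arch (4 * c).
pose j := maxn j0 j1; exists (j + 5)%N => w wj.
have jj0 : (j0 <= j)%N by rewrite leq_maxl.
have jj1 : (j1 <= j)%N by rewrite leq_maxr.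
have [||i|cv jet] := @jet_le_net_prod R nat
   (fun i s => artin_L rho (s + i%:R)) w
   (fun i => c * (2 ^+ j)^-1 * (2 ^+ i)^-1) (c * (2 ^+ j)^-1 * 2).
- by have := Hj1 _ jj1; lra.
- move=> J; apply: sum_fset_nat_le => [i|k].
    by rewrite !mulr_ge0 // invr_ge0 exprn_ge0.
  rewrite -mulr_sumr ler_wpM2l ?sum_exp2V_le //.
  by rewrite mulr_ge0 // invr_ge0 exprn_ge0.
- rewrite -mulrA -invfM -exprD.
  apply: (@jet_le_shift R (fun s => artin_L rho s - 1)).
  apply: Hj0; first exact: leq_trans (leq_addr _ _).
  by rewrite Re_addn addnAC natrD lerD2r.
(* Convergence along finite subsets of nat gives convergence along initial segments, which
   eventually contain any given finite set. *)
have seqcvg (z l : C) :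
    (fun J : {fset nat} => \prod_(i <- J) artin_L rho (z + i%:R))
      @ totally --> l ->
    (fun k : nat => \prod_(0 <= j < k) artin_L rho (z + j%:R)) @ \oo --> l.
  move=> Hl A /Hl [J _ HJ].
  exists (\max_(i <- J) i).+1 => // k /= Hk.
  have JP : perm_eq [fset i in iota 0 k]%fset (index_iota 0 k).
    apply: uniq_perm; rewrite ?fset_uniq ?iota_uniq // => i.
    by rewrite in_fset /index_iota subn0.
  rewrite /fmap /= -(perm_big _ JP); apply: HJ => /=.
  apply/fsubsetP => i iJ; rewrite in_fset mem_iota add0n.
  by apply: leq_ltn_trans Hk; rewrite leq_bigmax_seq.
split=> [h h1|].
  have /cvg_ex[l Hl] := cv h h1.
  by apply/cvg_ex; exists l; exact: seqcvg.
apply: (@jet_le_derivable _ _ _ (2 * (c * (2 ^+ j)^-1 * 2) + normc (1 : C))).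
apply: jet_le_eq (jet_leD jet (jet_le_cst 1 w)) => h h1; rewrite subrK.
have /cvg_ex[l Hl] := cv h h1.
have /cvg_lim Hs := seqcvg _ _ Hl.
by rewrite (cvg_lim _ Hl) // /artin_Ltilde Hs.
Qed.
End Artin.
End Factors.

(** * The entire continuation of Ltilde *)

Section Final.
Variable R : realType.
Local Notation C := (R[i]^o).

Lemma derivable_shift (f : C -> C) (a z : C) :
  derivable f (z + a) 1 -> derivable (fun s => f (s + a)) z 1.
Proof.
rewrite /derivable.
suff -> : (fun h => h^-1 *: (f (h *: (1 : C) + z + a) - f (z + a))) =
          (fun h => h^-1 *: (f (h *: (1 : C) + (z + a)) - f (z + a))) by [].
by apply/funext => h; rewrite addrA.
Qed.

Lemma derivable_prod (f : nat -> C -> C) (z : C) k :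
  (forall j, derivable (f j) z 1) ->
  derivable (fun s => \prod_(0 <= j < k) f j s) z 1.
Proof.
move=> Hf; elim: k => [|k IH].
  by under eq_fun do rewrite big_nil; exact: derivable_cst.
under eq_fun do rewrite big_nat_recr //=.
exact: (@derivableM R[i] C _ _ z 1 IH (Hf k)).
Qed.

Section Artin.
Variables (K : fieldExtType rat) (L : splittingFieldType K) (n : nat).
Variable rho : mx_representation R[i] 'Gal({:L} / 1%VS)%g n.
Lemma artin_Ltilde_entire :
  extends_to_entire (artin_L rho) -> extends_to_entire (artin_Ltilde rho).
Proof.
move=> [F Fent FL].
have [j0 Hj0] := artin_Ltilde_far rho.
pose G (s : C) : C :=
  lim ((fun k : nat => \prod_(0 <= j < k) F (s + j%:R)) @ \oo).
exists G => [z|s s1]; last first.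
  rewrite /G /artin_Ltilde.
  suff -> : (fun k : nat => \prod_(0 <= j < k) F (s + j%:R)) =
    (fun k => \prod_(0 <= j < k) artin_L rho (s + j%:R)) by [].
  apply/funext => k; apply: eq_bigr => j _; apply: FL; rewrite Re_addn.
  by rewrite ltr_wpDr.
(* The margin 3 keeps Re(z + h + k + j) above 1 for |h| <= 1, where F agrees with L. *)
have [k Hk] : exists k : nat, j0%:R + 3 <= complex.Re z + k%:R.
  exists (Num.bound `|j0%:R + 3 - complex.Re z|); rewrite -lerBlDl.
  by apply: le_trans (ler_norm _) (ltW (archi_boundP _)).
have [|cvT dT] := Hj0 (z + k%:R); first by rewrite Re_addn; lra.
pose P (s : C) : C := \prod_(0 <= j < k) F (s + j%:R).
have GE h : normc h <= 1 ->
    G (z + h) = P (z + h) * artin_Ltilde rho (z + h + k%:R).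
  move=> h1; have /cvg_ex[l Hl] := cvT h h1.
  have Hl' : (fun m : nat =>
      \prod_(0 <= j < m) artin_L rho (z + h + k%:R + j%:R)) @ \oo --> l.
    by rewrite [z + h + _]addrAC.
  have /cvg_lim LE := Hl'.
  suff /cvg_lim GE :
      (fun m : nat => \prod_(0 <= j < m) F (z + h + j%:R)) @ \oo -->
      P (z + h) * l.
    by rewrite /G /artin_Ltilde LE // GE.
  (* Starting the sequence at index [k] makes the first [k] factors split off as the fixed factor
     [P (z + h)]. *)
  rewrite -(cvg_shiftn k).
  have -> : (fun m => \prod_(0 <= j < m + k) F (z + h + j%:R)) =
    (fun m => P (z + h) * \prod_(0 <= j < m) artin_L rho (z + h + k%:R + j%:R)).
    apply/funext => m; rewrite (@big_cat_nat _ _ _ k) ?leq_addl //=.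
    congr (_ * _); rewrite -{1}[k]add0n big_addn addnK; apply: eq_bigr => j _.
    rewrite natrD [_%:R + k%:R]addrC addrA FL // !Re_addn raddfD /=.
    have /ler_normlP[] := le_trans (Re_le_normc h) h1.
    by have := ler0n R j; have := ler0n R j0; move: Hk; lra.
  by refine (cvgcM _ _ Hl'); exact: cvg_cst.
have dP : derivable P z 1.
  apply: (@derivable_prod (fun j s => F (s + j%:R))) => j.
  exact/derivable_shift/Fent.
have := @derivableM R[i] C _ _ z 1 dP (derivable_shift dT).
apply: near_eq_derivable.
have : (fun x : C => x) @ nbhs (z : C) --> (z : C) by exact: cvg_id.
move=> /cvgc_distP /(_ _ ltr01); apply: filterS => x.
rewrite normcB => /ltW/GE; rewrite addrC subrK => ->.
by [].
Qed.
End Artin.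
End Final.

Theorem corollary4p28 (R : realType) (K : fieldExtType rat)
  (L : splittingFieldType K) (n : nat)
  (rho : mx_representation R[i] 'Gal({:L} / 1%VS)%g n)
  (artin : artin_conjecture R)
  (galLK : galois 1%VS {:L})
  (irr_rho : mx_irreducible rho)
  (rho_neq1 : nontrivial_repr rho) :
  extends_to_entire (artin_Ltilde rho).
Proof. by apply: artin_Ltilde_entire; exact: artin. Qed.
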